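(* Assume that $\chi^{-1}(a)$ is a primitive $n$-th root of unity, where $n\geq 2$. (a) If $I=\langle x^n\rangle$, then $\{V_n(\lambda)\mid\lambda\in\widehat{G}\}$ is a representative set of isomorphism classes of finite dimensional indecomposable projective objects in $\mathcal{W}'$. (b) If $I=\langle x^n-\beta(1-a^n)\rangle$ with $\beta\in k^{\times}$, $a^n\neq 1$ and $n=|\chi|$, then $$\left\{V_n(\lambda),\ V(\sigma,\beta(1-\sigma(a)^n))\ \middle|\ \lambda\in\widehat{G}\text{ with }\lambda(a)^n=1,\ [\sigma]\in\widehat{G}/\langle\chi\rangle\text{ with }\sigma(a)^n\neq 1\right\}$$ (one $\sigma$ being chosen in each class $[\sigma]$) is a representative set of isomorphism classes of finite dimensional indecomposable projective objects in $\mathcal{W}'$.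
   Context: $k$ is a field, $G$ a group, $\widehat{G}$ the group of characters $G\to k^{\times}$, $\chi\in\widehat{G}$ of order $|\chi|$ (possibly $\infty$), and $a\in Z(G)$ with $\chi(a)\neq 1$. $H=kG(\chi^{-1},a,0)$ is the Hopf algebra generated as an algebra by $G$ and $x$ with relations $xg=\chi^{-1}(g)gx$ ($g\in G$), having $k$-basis $\{gx^i\mid g\in G,i\geq 0\}$, with $\Delta(x)=x\otimes a+1\otimes x$, $\varepsilon(x)=0$, $S(x)=-xa^{-1}$, and each $g\in G$ group-like. $\langle\chi\rangle$ is the subgroup of $\widehat{G}$ generated by $\chi$ and $[\sigma]$ is the class of $\sigma$ in $\widehat{G}/\langle\chi\rangle$. $H'=H/I$ is a rank one pointed quotient Hopf algebra of $H$; when $\chi^{-1}(a)$ is a primitive $n$-th root of unity with $n\geq 2$, the Hopf ideal $I$ is either $\langle x^n\rangle$, or $\langle x^n-\beta(1-a^n)\rangle$ with $\beta\in k^{\times}$, $a^n\neq 1$ and $|\chi|=n$. An $H'$-module is the same as an $H$-module $M$ with $I\cdot M=0$. For an $H$-module $M$ and $\lambda\in\widehat{G}$, $M_{(\lambda)}=\{v\in M\mid g\cdot v=\lambda(g)v\ \forall g\in G\}$; $M$ is a weight module if $M=\bigoplus_{\lambda\in\widehat{G}}M_{(\lambda)}$. $\mathcal{W}'$ is the category of all (not necessarily finite dimensional) $H'$-modules that are weight modules. For $t\geq 1$ and $\lambda\in\widehat{G}$, $V_t(\lambda)$ is the $t$-dimensional $H$-module with $k$-basis $m_0,\dots,m_{t-1}$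 and action $g\cdot m_i=\chi^i(g)\lambda(g)m_i$; $x\cdot m_i=m_{i+1}$ for $0\leq i\leq t-2$; $x\cdot m_{t-1}=0$. If $|\chi|=s<\infty$, $\lambda\in\widehat{G}$ and $\gamma\in k$, then $V(\lambda,\gamma)$ is the $H$-module with $k$-basis $m_0,\dots,m_{s-1}$ and action $g\cdot m_i=\chi^i(g)\lambda(g)m_i$; $x\cdot m_i=m_{i+1}$ for $0\leq i\leq s-2$; $x\cdot m_{s-1}=\gamma m_0$. *)

(* Defs.v *)
From HB Require Import structures.
From mathcomp Require Import all_boot all_algebra finmap boolp.
From mathcomp.multinomials Require Import monalg.

Set Implicit Arguments.
Unset Strict Implicit.
Unset Printing Implicit Defensive.

Import GRing.Theory.
Local Open Scope ring_scope.

Section Characters.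
Variables (k : fieldType) (G : groupType).

Record character := Character {
  char_val :> G -> k;
  char_neq0 : forall g, char_val g != 0;
  charM : forall g h, char_val (g * h)%g = char_val g * char_val h }.

HB.instance Definition _ := gen_eqMixin character.
HB.instance Definition _ := gen_choiceMixin character.

Lemma char_ext (f g : character) : (forall x, f x = g x) -> f = g.
Proof.
case: f g => [f f0 fM] [g g0 gM] /= fg.
have E : f = g by apply/funext.
by subst g; congr Character; apply: Prop_irrelevance.
Qed.

Lemma char1 (f : character) : f 1%g = 1.
Proof.
by apply: (mulfI (char_neq0 f 1%g)); rewrite -charM mulg1 mulr1.
Qed.

Program Definition char_one : character := @Character (fun=> 1) _ _.
Next Obligation. by rewrite oner_neq0. Qed.
Next Obligation. by rewrite mulr1. Qed.

Program Definition char_mul (f g : character) : character :=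
  @Character (fun x => f x * g x) _ _.
Next Obligation. by rewrite mulf_neq0 ?char_neq0. Qed.
Next Obligation. by rewrite !charM mulrACA. Qed.

Program Definition char_inv (f : character) : character :=
  @Character (fun x => (f x)^-1) _ _.
Next Obligation. by rewrite invr_eq0 char_neq0. Qed.
Next Obligation. by rewrite charM invfM. Qed.

Fact char_mulA : associative char_mul.
Proof. by move=> f g h; apply: char_ext => x /=; rewrite mulrA. Qed.
Fact char_mul1 : left_id char_one char_mul.
Proof. by move=> f; apply: char_ext => x /=; rewrite mul1r. Qed.
Fact char_mulr1 : right_id char_one char_mul.
Proof. by move=> f; apply: char_ext => x /=; rewrite mulr1. Qed.
Fact char_mulV : left_inverse char_one char_inv char_mul.
Proof. by move=> f; apply: char_ext => x /=; rewrite mulVf ?char_neq0. Qed.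
Fact char_mulrV : right_inverse char_one char_inv char_mul.
Proof. by move=> f; apply: char_ext => x /=; rewrite mulfV ?char_neq0. Qed.

HB.instance Definition _ := isGroup.Build character
  char_mulA char_mul1 char_mulr1 char_mulV char_mulrV.

Lemma char_oneE g : (1%g : character) g = 1. Proof. by []. Qed.
Lemma char_mulE (f h : character) g : (f * h)%g g = f g * h g.
Proof. by []. Qed.
Lemma char_invE (f : character) g : (f^-1)%g g = (f g)^-1.
Proof. by []. Qed.
Lemma char_expE (f : character) m g : (f ^+ m)%g g = f g ^+ m.
Proof. by elim: m => // m IH; rewrite expgS char_mulE IH exprS. Qed.

Definition has_order (chi : character) (n : nat) : Prop :=
  [/\ (0 < n)%N, (chi ^+ n)%g = 1%g
    & forall m, (0 < m < n)%N -> (chi ^+ m)%g <> 1%g].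

Definition in_cycle (chi tau : character) : Prop :=
  exists m : nat, tau = (chi ^+ m)%g \/ tau = (chi ^- m)%g.

Definition same_class (chi sigma tau : character) : Prop :=
  in_cycle chi (sigma^-1 * tau)%g.

End Characters.

Section LinearExtension.
Variables (k : fieldType) (K : choiceType) (V : lmodType k).
Implicit Types (f : K -> V) (p q : {malg k[K]}).

Definition linext f p : V := \sum_(u <- msupp p) p@_u *: f u.

Lemma linextEw f p (d : {fset K}) : (msupp p `<=` d)%fset ->
  linext f p = \sum_(u <- d) p@_u *: f u.
Proof.
move=> le; rewrite /linext (big_fset_incl _ le) //.
by move=> u _ /mcoeff_outdom ->; rewrite scale0r.
Qed.

Lemma linext_linear f : linear (linext f).
Proof.
move=> c p q.
pose d := (msupp p `|` (msupp q `|` msupp (c *: p + q)))%fset.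
rewrite !(@linextEw _ _ d) /d ?fsubsetUl //; last first.
- by rewrite fsetUA fsubsetUr.
- by rewrite fsetUCA fsubsetUl.
rewrite scaler_sumr -big_split /=; apply: eq_bigr => u _.
by rewrite mcoeffD mcoeffZ scalerDl scalerA.
Qed.

HB.instance Definition _ f :=
  GRing.isLinear.Build k {malg k[K]} V _ (linext f) (linext_linear f).

Lemma linextU f c u : linext f << c *g u >> = c *: f u.
Proof.
rewrite (@linextEw _ _ [fset u]%fset) ?msuppU_le //.
by rewrite big_seq_fset1 mcoeffUU.
Qed.

Lemma linext_id_ext f p (g : {linear {malg k[K]} -> V}) :
  (forall u, g << u >> = f u) -> linext f p = g p.
Proof.
move=> E; rewrite [in RHS](monalgE p) linear_sum; apply: eq_bigr => u _.
have -> : << p@_u *g u >> = p@_u *: << u >> :> {malg k[K]}.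
  by apply/malgP => v; rewrite mcoeffZ !mcoeffU mulr_natr.
by rewrite linearZ /= E.
Qed.

Lemma linext_sub (f g : K -> V) : f =1 g -> linext f =1 linext g.
Proof. by move=> E p; apply: eq_bigr => u _; rewrite E. Qed.

Lemma linext_add (f g : K -> V) c p :
  linext (fun u => c *: f u + g u) p = c *: linext f p + linext g p.
Proof.
rewrite /linext scaler_sumr -big_split /=; apply: eq_bigr => u _.
by rewrite scalerDr !scalerA mulrC.
Qed.

End LinearExtension.

Lemma linext_comp (k : fieldType) (K : choiceType) (V W : lmodType k)
    (h : {linear V -> W}) (f : K -> V) p :
  h (linext f p) = linext (h \o f) p.
Proof. by rewrite linear_sum; apply: eq_bigr => u _; rewrite linearZ. Qed.

Section Algebra.
Variables (k : fieldType) (G : groupType) (chi : character k G).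

(* The pair (g, i) stands for the basis element g x^i; the product of two
   basis elements is forced by x h = chi^-1(h) h x.  The algebra underlying
   kG(chi^-1, a, 0) does not depend on a, which only enters its coproduct
   and antipode. *)
Definition kGx of character k G : Type := {malg k[(G * nat)%type]}.

Local Notation H := (kGx chi).

HB.instance Definition _ := GRing.Lmodule.on H.

Implicit Types p q r : H.

Definition kGx_mulU (u v : G * nat) : H :=
  << (chi^-1)%g v.1 ^+ u.2 *g ((u.1 * v.1)%g, (u.2 + v.2)%N) >>.

Definition kGx_mul p q : H :=
  linext (fun u => linext (kGx_mulU u) q) p.

Definition kGx_one : H := << (1%g, 0%N) >>.

Lemma kGx_mulEr p q :
  kGx_mul p q = linext (fun v => linext (kGx_mulU^~ v) p) q.
Proof.
rewrite /kGx_mul /linext; under eq_bigr do rewrite scaler_sumr.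
rewrite exchange_big /=; apply: eq_bigr => v _.
rewrite scaler_sumr; apply: eq_bigr => u _.
by rewrite !scalerA mulrC.
Qed.

Definition kGx_mulr q p := kGx_mul p q.

Fact kGx_mul_linl q : linear (kGx_mulr q).
Proof. by move=> c p r; rewrite /kGx_mulr /kGx_mul linearP. Qed.

Fact kGx_mul_linr p : linear (kGx_mul p).
Proof. by move=> c q r; rewrite !kGx_mulEr linearP. Qed.

HB.instance Definition _ q :=
  GRing.isLinear.Build k H H _ (kGx_mulr q) (kGx_mul_linl q).
HB.instance Definition _ p :=
  GRing.isLinear.Build k H H _ (kGx_mul p) (kGx_mul_linr p).

Lemma kGx_ind (V : lmodType k) (f g : {linear H -> V}) :
  (forall u, f << u >> = g << u >>) -> f =1 g.
Proof.
move=> E p; rewrite -(@linext_id_ext _ _ _ (fun u => f << u >>) p f) //.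
by apply: (@linext_id_ext _ _ _ _ p g) => u; rewrite E.
Qed.

Lemma malgUZ c (u : G * nat) : << c *g u >> = c *: << u >> :> H.
Proof. by apply/malgP => v; rewrite mcoeffZ !mcoeffU mulr_natr. Qed.

Lemma kGx_mulUU u v : kGx_mul << u >> << v >> = kGx_mulU u v.
Proof. by rewrite /kGx_mul !linextU !scale1r. Qed.

Lemma kGx_mulUUZ u v : kGx_mulU u v =
  (chi^-1)%g v.1 ^+ u.2 *: << ((u.1 * v.1)%g, (u.2 + v.2)%N) >>.
Proof. exact: malgUZ. Qed.

Fact kGx_mulA : associative kGx_mul.
Proof.
move=> p q r.
pose L1 q r : {linear H -> H} := kGx_mulr (kGx_mul q r).
pose L2 q r : {linear H -> H} := kGx_mulr r \o kGx_mulr q.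
apply: (@kGx_ind _ (L1 q r) (L2 q r) _ p) => u; rewrite /L1 /L2 /=.
pose M1 r : {linear H -> H} := kGx_mul << u >> \o kGx_mulr r.
pose M2 r : {linear H -> H} := kGx_mulr r \o kGx_mul << u >>.
apply: (@kGx_ind _ (M1 r) (M2 r) _ q) => v; rewrite /M1 /M2 /=.
pose N1 : {linear H -> H} := kGx_mul << u >> \o kGx_mul << v >>.
pose N2 : {linear H -> H} := kGx_mul (kGx_mul << u >> << v >>).
apply: (@kGx_ind _ N1 N2 _ r) => w; rewrite /N1 /N2 /=.
rewrite !kGx_mulUU !kGx_mulUUZ linearZ /=.
rewrite -[RHS]/((kGx_mulr << w >>) (_ *: _)) linearZ /=.
rewrite /kGx_mulr !kGx_mulUU !kGx_mulUUZ !scalerA /= mulgA addnA; congr (_ *: _).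
by rewrite charM invfM exprMn exprD [LHS]mulrC mulrA.
Qed.

Fact kGx_mul1 : left_id kGx_one kGx_mul.
Proof.
apply: (@kGx_ind _ (kGx_mul kGx_one) idfun) => v /=.
by rewrite kGx_mulUU kGx_mulUUZ /= expr0 scale1r mul1g add0n -surjective_pairing.
Qed.

Fact kGx_mulr1 : right_id kGx_one kGx_mul.
Proof.
apply: (@kGx_ind _ (kGx_mulr kGx_one) idfun) => v /=.
rewrite /kGx_mulr kGx_mulUU kGx_mulUUZ char1 expr1n scale1r mulg1 addn0.
by rewrite -surjective_pairing.
Qed.

Fact kGx_mulDl : left_distributive kGx_mul +%R.
Proof. by move=> p q r; rewrite -[LHS]/(kGx_mulr r (_ + _)) linearD. Qed.
Fact kGx_mulDr : right_distributive kGx_mul +%R.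
Proof. by move=> p q r; rewrite linearD. Qed.
Fact kGx_1neq0 : kGx_one != 0.
Proof. by rewrite /kGx_one monalgU_eq0 oner_neq0. Qed.

HB.instance Definition _ := GRing.Zmodule_isNzRing.Build H
  kGx_mulA kGx_mul1 kGx_mulr1 kGx_mulDl kGx_mulDr kGx_1neq0.

Fact kGx_scaleAl (c : k) p q : c *: (p * q) = (c *: p) * q.
Proof. by rewrite -[RHS]/((kGx_mulr q) (_ *: _)) linearZ. Qed.
HB.instance Definition _ := GRing.Lmodule_isLalgebra.Build k H kGx_scaleAl.
Fact kGx_scaleAr (c : k) p q : c *: (p * q) = p * (c *: q).
Proof. by rewrite -[RHS]/(kGx_mul p (_ *: _)) linearZ. Qed.
HB.instance Definition _ := GRing.Lalgebra_isAlgebra.Build k H kGx_scaleAr.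

Definition Hg (g : G) : H := << (g, 0%N) >>.
Definition Hx : H := << (1%g, 1%N) >>.

Lemma Hg1 : Hg 1%g = 1. Proof. by []. Qed.

Lemma HgM g h : Hg (g * h)%g = Hg g * Hg h.
Proof.
by rewrite -[RHS]/(kGx_mul _ _) kGx_mulUU kGx_mulUUZ /= expr0 scale1r.
Qed.

Lemma Hxg g : Hx * Hg g = (chi^-1)%g g *: (Hg g * Hx).
Proof.
rewrite -![_ * _]/(kGx_mul _ _) !kGx_mulUU !kGx_mulUUZ /=.
by rewrite expr1 expr0 scale1r mul1g mulg1 addn0 add0n.
Qed.

Lemma HgxE g i : Hg g * Hx ^+ i = << (g, i) >>.
Proof.
elim: i => [|i IH]; first by rewrite expr0 mulr1.
rewrite exprSr mulrA IH -[LHS]/(kGx_mul _ _) kGx_mulUU kGx_mulUUZ /=.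
by rewrite char1 invr1 expr1n scale1r mulg1 addn1.
Qed.

End Algebra.

Section FromRepresentation.
Variables (k : fieldType) (G : groupType) (chi : character k G).

Record hrep (V : lmodType k) := HRep {
  hrho : G -> {linear V -> V};
  hX : {linear V -> V};
  hrho1 : forall v, hrho 1%g v = v;
  hrhoM : forall g h v, hrho (g * h)%g v = hrho g (hrho h v);
  hXrho : forall g v, hX (hrho g v) = (chi^-1)%g g *: hrho g (hX v) }.

Variables (V : lmodType k) (r : hrep V).

Definition hmod_type of hrep V : Type := V.

HB.instance Definition _ := GRing.Zmodule.copy (hmod_type r) V.

Definition hact (h : kGx chi) (v : V) : V :=
  linext (fun u => hrho r u.1 (iter u.2 (hX r) v)) h.

Definition hactr (v : V) (h : kGx chi) : V := hact h v.

Fact hact_linl v : linear (hactr v).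
Proof. by move=> c p q; rewrite /hactr /hact linearP. Qed.
Fact hact_linr h : linear (hact h).
Proof.
move=> c v w; rewrite /hact -linext_add; apply: linext_sub => u.
have E i : iter i (hX r) (c *: v + w) =
    c *: iter i (hX r) v + iter i (hX r) w.
  by elim: i => //= i ->; rewrite linearP.
by rewrite E linearP.
Qed.
HB.instance Definition _ v :=
  GRing.isLinear.Build k (kGx chi) V _ (hactr v) (hact_linl v).
HB.instance Definition _ h :=
  GRing.isLinear.Build k V V _ (hact h) (hact_linr h).

Lemma hactU u v : hact << u >> v = hrho r u.1 (iter u.2 (hX r) v).
Proof. by rewrite /hact linextU scale1r. Qed.

Lemma iter_hX_hrho i g v : iter i (hX r) (hrho r g v) =
  (chi^-1)%g g ^+ i *: hrho r g (iter i (hX r) v).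
Proof.
elim: i => [|i IH] /=; first by rewrite expr0 scale1r.
by rewrite IH linearZ /= hXrho scalerA exprSr.
Qed.

Fact hactA (p q : kGx chi) v : hact p (hact q v) = hact (p * q) v.
Proof.
pose L1 q : {linear kGx chi -> V} := hactr (hact q v).
pose L2 q : {linear kGx chi -> V} := hactr v \o @kGx_mulr _ _ chi q.
apply: (@kGx_ind _ _ _ _ (L1 q) (L2 q) _ p) => u; rewrite /L1 /L2 /=.
pose M1 : {linear kGx chi -> V} := hact << u >> \o hactr v.
pose M2 : {linear kGx chi -> V} := hactr v \o @kGx_mul _ _ chi << u >>.
apply: (@kGx_ind _ _ _ _ M1 M2 _ q) => w; rewrite /M1 /M2 /=.
rewrite kGx_mulUU kGx_mulUUZ -[RHS]/((hactr v) (_ *: _)) linearZ /=.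
by rewrite /hactr !hactU /= iter_hX_hrho linearZ /= hrhoM iterD.
Qed.

Fact hact1 : left_id 1 hact.
Proof. by move=> v; rewrite -[1]/(<< (1%g, 0%N) >>) hactU /= hrho1. Qed.
Fact hactDr : right_distributive hact +%R.
Proof. by move=> h v w; rewrite linearD. Qed.
Fact hactDl v : {morph hact^~ v : p q / p + q}.
Proof. by move=> p q; rewrite -[LHS]/(hactr v (_ + _)) linearD. Qed.

HB.instance Definition _ := GRing.Zmodule_isLmodule.Build (kGx chi)
  (hmod_type r) hactA hact1 hactDr hactDl.

Definition hmod : lmodType (kGx chi) := hmod_type r.

End FromRepresentation.

Section CyclicModules.
Variables (k : fieldType) (G : groupType) (chi : character k G).

(* Common construction of V_t(lambda) (gamma = 0) and V(lambda, gamma)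
   (chi^t = 1), on row vectors with m_i = delta_mx 0 i.  As ord_pred is the
   cyclic predecessor, x m_(t-1) = gamma m_0. *)
Definition cyc_rho t (lambda : character k G) (g : G) (v : 'rV[k]_t) :
    'rV[k]_t :=
  \row_j (chi g ^+ j * lambda g * v 0 j).

Definition cyc_X t (gamma : k) (v : 'rV[k]_t) : 'rV[k]_t :=
  \row_j ((if j == 0%N :> nat then gamma else 1) * v 0 (ord_pred j)).

Fact cyc_rho_linear t lambda g : linear (@cyc_rho t lambda g).
Proof. by move=> c v w; apply/rowP => j; rewrite !mxE mulrDr mulrCA. Qed.
HB.instance Definition _ t lambda g :=
  GRing.isLinear.Build k 'rV[k]_t 'rV[k]_t _ (@cyc_rho t lambda g)
    (@cyc_rho_linear t lambda g).

Fact cyc_X_linear t gamma : linear (@cyc_X t gamma).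
Proof. by move=> c v w; apply/rowP => j; rewrite !mxE mulrDr mulrCA. Qed.
HB.instance Definition _ t gamma :=
  GRing.isLinear.Build k 'rV[k]_t 'rV[k]_t _ (@cyc_X t gamma)
    (@cyc_X_linear t gamma).

Fact cyc_rho1 t lambda v : @cyc_rho t lambda 1%g v = v.
Proof. by apply/rowP => j; rewrite mxE !char1 expr1n !mul1r. Qed.

Fact cyc_rhoM t lambda g h v :
  @cyc_rho t lambda (g * h)%g v = cyc_rho lambda g (cyc_rho lambda h v).
Proof.
apply/rowP => j; rewrite !mxE !charM exprMn !mulrA; congr (_ * _ * _).
by rewrite mulrAC.
Qed.

Fact cyc_Xrho t lambda gamma : gamma = 0 \/ (chi ^+ t)%g = 1%g ->
  forall g v, @cyc_X t gamma (cyc_rho lambda g v) =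
    (chi^-1)%g g *: cyc_rho lambda g (cyc_X gamma v).
Proof.
move=> Hg g v; apply/rowP => j; rewrite !mxE.
have chi0 := char_neq0 chi g.
have t0 : (0 < t)%N by case: (t) j => [[]|].
rewrite char_invE; case: ifP => [/eqP j0|/negbT]; last first.
  rewrite -lt0n => j0.
  have -> : ord_pred j = j.-1 :> nat.
    rewrite /= -(prednK j0) addSn /= modnDr modn_small //.
    by rewrite (leq_ltn_trans (leq_pred j)).
  rewrite -{2}(prednK j0) exprS !mul1r !mulrA mulVf // mul1r.
  by [].
case: Hg => [->|Ht]; first by rewrite !mul0r !mulr0.
have -> : ord_pred j = t.-1 :> nat by rewrite /= j0 add0n modn_small ?prednK.
have E : chi g ^+ t.-1 = (chi g)^-1.
  apply: (mulfI chi0); rewrite -exprS prednK // mulfV //.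
  by rewrite -char_expE Ht.
rewrite E j0 expr0 !mul1r -!mulrA mulrCA; congr (_ * _).
by rewrite !mulrA (mulrC gamma).
Qed.

Definition cyc_rep t lambda gamma
    (hg : gamma = 0 \/ (chi ^+ t)%g = 1%g) : hrep chi 'rV[k]_t :=
  @HRep k G chi 'rV[k]_t (fun g => @cyc_rho t lambda g) (@cyc_X t gamma)
    (@cyc_rho1 t lambda) (@cyc_rhoM t lambda) (cyc_Xrho lambda hg).

Definition Vnil (t : nat) (lambda : character k G) : lmodType (kGx chi) :=
  hmod (@cyc_rep t lambda 0 (or_introl erefl)).

Definition Vcyc (s : nat) (hs : has_order chi s) (lambda : character k G)
    (gamma : k) : lmodType (kGx chi) :=
  hmod (@cyc_rep s lambda gamma
    (or_intror (let: And3 _ e _ := hs in e))).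

Section Basis.
Variables (t : nat) (lambda : character k G) (gamma : k).
Hypothesis hg : gamma = 0 \/ (chi ^+ t)%g = 1%g.
Local Notation M := (hmod (cyc_rep lambda hg)).
Local Notation m i := (delta_mx 0 i : 'rV[k]_t).

Lemma cyc_scaleE (c : k) (v : M) :
  (c%:A : kGx chi) *: v = c *: (v : 'rV[k]_t) :> 'rV[k]_t.
Proof.
rewrite -[LHS]/(hact _ _ _) -[LHS]/(hactr _ v (_ *: _)) linearZ /=.
by rewrite /hactr hact1.
Qed.

Lemma cyc_gE g (i : 'I_t) :
  Hg chi g *: (m i : M) = (chi g ^+ i * lambda g) *: m i :> 'rV[k]_t.
Proof.
rewrite -[LHS]/(hact _ _ _) hactU /=; apply/rowP => j; rewrite !mxE /=.
by case: eqP => [->|]; rewrite ?mulr1 ?mulr0.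
Qed.

Lemma cyc_x_ordS (i : 'I_t) :
  Hx chi *: (m i : M) = (if ordS i == 0%N :> nat then gamma else 1) *: m (ordS i)
    :> 'rV[k]_t.
Proof.
rewrite -[LHS]/(hact _ _ _) hactU /= cyc_rho1; apply/rowP => l; rewrite !mxE.
rewrite !eqxx (can2_eq (@ord_predK t) (@ordSK t)).
by case: (eqVneq l (ordS i)) => [->|_] //; rewrite !mulr0.
Qed.

Lemma cyc_xE (i j : 'I_t) : j = i.+1 :> nat ->
  Hx chi *: (m i : M) = m j :> 'rV[k]_t.
Proof.
move=> ij; have -> : j = ordS i.
  by apply: val_inj; rewrite /= -ij modn_small.
by rewrite cyc_x_ordS /= -ij modn_small // ij scale1r.
Qed.

Lemma cyc_x_last (i j : 'I_t) : i = t.-1 :> nat -> j = 0%N :> nat ->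
  Hx chi *: (m i : M) = gamma *: m j :> 'rV[k]_t.
Proof.
move=> it j0; have iS : i.+1 = t by rewrite it prednK // (leq_trans _ (ltn_ord i)).
have -> : j = ordS i by apply: val_inj; rewrite /= iS modnn.
by rewrite cyc_x_ordS /= iS modnn.
Qed.

End Basis.

End CyclicModules.

Section WeightModules.
Variables (k : fieldType) (G : groupType) (chi : character k G).
Local Notation H := (kGx chi).
Implicit Types M : lmodType H.

Definition weight_space M (lambda : character k G) (v : M) : Prop :=
  forall g, Hg chi g *: v = ((lambda g)%:A : H) *: v.

Definition weight_module M : Prop :=
  (forall v : M, exists (s : seq (character k G)) (f : character k G -> M),
     (forall lambda, weight_space lambda (f lambda)) /\
     v = \sum_(lambda <- s) f lambda) /\
  (forall (s : seq (character k G)) (f : character k G -> M), uniq s ->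
     (forall lambda, weight_space lambda (f lambda)) ->
     \sum_(lambda <- s) f lambda = 0 ->
     forall lambda, lambda \in s -> f lambda = 0).

Definition ideal_gen (z h : H) : Prop :=
  exists (m : nat) (p q : 'I_m -> H), h = \sum_(i < m) p i * z * q i.

Definition annihilates (I : H -> Prop) M : Prop :=
  forall h, I h -> forall v : M, h *: v = 0.

(* Modules over H' = H / I are identified with H-modules killed by I. *)
Definition Wprime (I : H -> Prop) M : Prop :=
  annihilates I M /\ weight_module M.

Definition fin_dim M : Prop :=
  exists (d : nat) (b : 'I_d -> M), forall v : M,
    exists c : 'I_d -> k, v = \sum_(i < d) ((c i)%:A : H) *: b i.

End WeightModules.

(* Notions relative to the full subcategory of R-modules with objects W. *)
Section FullSubcategory.
Variables (R : nzRingType) (W : lmodType R -> Prop).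

Definition iso_mod (M N : lmodType R) : Prop :=
  exists f : {linear M -> N}, bijective f.

Definition epimorphism (M N : lmodType R) (f : {linear M -> N}) : Prop :=
  forall (Q : lmodType R) (u v : {linear N -> Q}), W Q ->
    (forall m, u (f m) = v (f m)) -> forall n, u n = v n.

Definition projective_object (P : lmodType R) : Prop :=
  W P /\
  forall (M N : lmodType R) (f : {linear M -> N}) (g : {linear P -> N}),
    W M -> W N -> epimorphism f ->
    exists h : {linear P -> M}, forall p, f (h p) = g p.

Definition zero_module (M : lmodType R) : Prop := forall v : M, v = 0.

Definition indecomposable (P : lmodType R) : Prop :=
  ~ zero_module P /\
  forall A B : lmodType R, W A -> W B ->
    iso_mod P (A * B)%type -> zero_module A \/ zero_module B.

End FullSubcategory.

Definition representative_family (R : nzRingType) (C : lmodType R -> Prop)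
    (J : Type) (F : J -> lmodType R) : Prop :=
  [/\ forall j, C (F j),
      forall M, C M -> exists j, iso_mod M (F j)
    & forall i j, iso_mod (F i) (F j) -> i = j].

Section Statement.
Variables (k : fieldType) (G : groupType) (chi : character k G).

Definition fd_indec_proj (I : kGx chi -> Prop) (P : lmodType (kGx chi)) :
    Prop :=
  [/\ fin_dim P, indecomposable (Wprime I) P
    & projective_object (Wprime I) P].

(* T picks exactly one sigma in each class [sigma] of the quotient by <chi>
   with sigma(a)^n != 1. *)
Definition transversal_of (a : G) (n : nat) (T : pred (character k G)) :
    Prop :=
  (forall sigma, T sigma -> sigma a ^+ n != 1) /\
  (forall sigma : character k G, sigma a ^+ n != 1 ->
     exists! tau, T tau /\ same_class chi sigma tau).

Definition family_b (a : G) (n : nat) (hn : has_order chi n) (beta : k)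
    (T : pred (character k G))
    (j : {lambda : character k G | lambda a ^+ n == 1} + {sigma | T sigma}) :
    lmodType (kGx chi) :=
  match j with
  | inl lambda => Vnil chi n (val lambda)
  | inr sigma =>
      Vcyc hn (val sigma) (beta * (1 - (val sigma : character k G) a ^+ n))
  end.

End Statement.

(* Main.v *)
From HB Require Import structures.
Require Import Defs.
From mathcomp Require Import all_boot all_algebra finmap boolp.
From mathcomp.multinomials Require Import monalg.

(** The two ideals are treated at once.  In both cases a weight module M is
    killed by the ideal exactly when x^n acts on every weight vector of weight
    lam as a scalar gam lam, where gam lam = 0 in the first case and
    gam lam = beta (1 - lam(a)^n) in the second; in both cases gam is
    invariant under multiplication by chi.  Let E(lam) be the n-dimensional
    cyclic module with x m_(n-1) = gam lam m_0.

    E(lam) has a universal property on each side.  A map from E(lam) to an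
    object M of the category is the choice of a vector of weight lam in M
    ([cyc_hom]); as weight spaces lift along surjections, E(lam) is projective.
    A map from M to E(lam) is the choice of a functional on the weight space of
    weight chi^(n-1) lam ([cyc_cohom]).  Since chi(a) has order n, the weights
    chi^i lam of E(lam) for i < n are distinct, so its weight space of weight
    lam is a line, its endomorphisms are scalars, and it is indecomposable.

    Conversely, let P be a finite dimensional indecomposable projective object.
    It is enough to find a map P -> E(lam) hitting m_0: the surjection splits
    by projectivity of E(lam), and P = E(lam) by indecomposability
    ([iso_cover_of_hit]).  If P has a nonzero vector w of weight lam with
    gam lam <> 0, then x^(n-1) w <> 0, and a functional not vanishing there
    gives such a map by the second universal property.  Otherwise x is nilpotent
    on P, so P <> xP, and P maps onto a one-dimensional module on which x is
    zero; projectivity of P lifts this map to E(lam), which has that module as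
    its head.

    Finally, weights of E(mu) are of the form chi^i mu.  When gam mu = 0 only
    vectors with a nonzero component of weight mu survive x^(n-1), so that mu is
    determined by E(mu); when gam mu <> 0, multiplication by x identifies
    E(chi mu) with E(mu), so that E(mu) depends only on the class of mu modulo
    powers of chi. *)

Set Implicit Arguments.
Unset Strict Implicit.
Unset Printing Implicit Defensive.

Import GRing.Theory.
Local Open Scope ring_scope.
Local Open Scope quotient_scope.

(** * Cokernels and isomorphisms of modules *)

Section Modules.
Variable R : nzRingType.
Implicit Types M N : lmodType R.

Lemma linear_of_fun M N (F : M -> N) :
  linear F -> exists f : {linear M -> N}, forall v, f v = F v.
Proof.
move=> hF; pose L := GRing.isLinear.Build R M N *:%R F hF.
by exists (HB.pack_for {linear M -> N} F L).
Qed.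

Lemma iso_mod_refl M : iso_mod M M.
Proof.
have [f fE] := @linear_of_fun M M idfun (fun c u v => erefl).
by exists f, idfun => v; rewrite fE.
Qed.

Lemma iso_mod_sym M N : iso_mod M N -> iso_mod N M.
Proof.
case=> f [g fK gK].
have [h hE] : exists h : {linear N -> M}, forall v, h v = g v.
  by apply: linear_of_fun => c u v; rewrite -[RHS]fK linearP !gK.
by exists h, f => v; rewrite hE.
Qed.

Lemma iso_mod_trans M N P : iso_mod M N -> iso_mod N P -> iso_mod M P.
Proof.
by move=> [f bf] [g bg]; exists (g \o f); apply: bij_comp.
Qed.

Section Cokernel.
Variables (M N : lmodType R) (f : {linear M -> N}).

Definition im_pred : {pred N} := fun y => `[< exists m, y = f m >].

Fact im_pred_submod : submod_closed im_pred.
Proof.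
split; first by apply/asboolP; exists 0; rewrite linear0.
move=> c _ _ /asboolP[m ->] /asboolP[m' ->].
by apply/asboolP; exists (c *: m + m'); rewrite linearP.
Qed.
HB.instance Definition _ := GRing.isSubmodClosed.Build R N im_pred im_pred_submod.

(** The cokernel serves twice: quotients of objects of the category stay in it,
    which makes its epimorphisms surjective, and a split injection has its
    cokernel as a complement. *)
Definition coker_type : Type := {ideal_quot im_pred}.
HB.instance Definition _ := GRing.Zmodule.on coker_type.

Definition to_coker (y : N) : coker_type := \pi_({ideal_quot im_pred}) y.

Lemma to_coker_eq y y' : (to_coker y = to_coker y') <-> exists m, y - y' = f m.
Proof.
split=> [/eqP|H]; first by rewrite -Quotient.idealrBE => /asboolP.
by apply/eqP; rewrite -Quotient.idealrBE; apply/asboolP.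
Qed.

Fact to_cokerD : {morph to_coker : x y / x + y}.
Proof. by move=> x y; rewrite /to_coker raddfD. Qed.

Lemma to_coker_surj (q : coker_type) : exists y, to_coker y = q.
Proof. by exists (repr q); rewrite /to_coker reprK. Qed.

Definition coker_scale (c : R) (q : coker_type) : coker_type :=
  to_coker (c *: repr (q : {ideal_quot im_pred})).

Lemma coker_scaleE c y : coker_scale c (to_coker y) = to_coker (c *: y).
Proof.
apply/to_coker_eq; rewrite -scalerBr.
have /to_coker_eq[m ->] : to_coker (repr (to_coker y : {ideal_quot im_pred})) = to_coker y.
  by rewrite /to_coker reprK.
by exists (c *: m); rewrite linearZ.
Qed.

Fact coker_scaleA c d q : coker_scale c (coker_scale d q) = coker_scale (c * d) q.
Proof. by have [y <-] := to_coker_surj q; rewrite !coker_scaleE scalerA. Qed.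
Fact coker_scale1 : left_id 1 coker_scale.
Proof.
by move=> q; have [y <-] := to_coker_surj q; rewrite !coker_scaleE scale1r.
Qed.
Fact coker_scaleDr : right_distributive coker_scale +%R.
Proof.
move=> c q r; have [y <-] := to_coker_surj q; have [y' <-] := to_coker_surj r.
by rewrite -to_cokerD !coker_scaleE scalerDr to_cokerD.
Qed.
Fact coker_scaleDl q : {morph coker_scale^~ q : c d / c + d}.
Proof.
by move=> c d; have [y <-] := to_coker_surj q; rewrite !coker_scaleE scalerDl to_cokerD.
Qed.
HB.instance Definition _ := GRing.Zmodule_isLmodule.Build R coker_type
  coker_scaleA coker_scale1 coker_scaleDr coker_scaleDl.

Definition coker : lmodType R := coker_type.

Fact to_coker_linear : linear (to_coker : N -> coker).
Proof. by move=> c x y; rewrite to_cokerD -coker_scaleE. Qed.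

Lemma to_coker_spec : exists pi : {linear N -> coker},
  (forall q, exists y, pi y = q) /\
  (forall y, pi y = 0 <-> exists m, y = f m).
Proof.
have [pi piE] := linear_of_fun to_coker_linear.
exists pi; split=> [q|y].
  by have [y <-] := to_coker_surj q; exists y; rewrite piE.
rewrite -(linear0 pi) !piE to_coker_eq subr0; exact: iff_refl.
Qed.

End Cokernel.
End Modules.

(** * Weight vectors *)

Section WeightVectors.
Variables (k : fieldType) (G : groupType) (chi : character k G).
Local Notation H := (kGx chi).
Local Notation "c *k v" := ((c%:A : H) *: v) (at level 40).
Local Notation x := (Hx chi).
Local Notation hg := (Hg chi).
Implicit Types (M N P : lmodType H) (lam mu nu : character k G).

Lemma kscale0 M (v : M) : 0 *k v = 0. Proof. by rewrite !scale0r. Qed.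
Lemma kscale1 M (v : M) : 1 *k v = v. Proof. by rewrite !scale1r. Qed.
Lemma kscaleA M (c d : k) (v : M) : c *k (d *k v) = (c * d) *k v.
Proof. by rewrite scalerA mulr_algl scalerA. Qed.
Lemma kscaleD M (c d : k) (v : M) : (c + d) *k v = c *k v + d *k v.
Proof. by rewrite !scalerDl. Qed.
Lemma kscaleB M (c d : k) (v : M) : (c - d) *k v = c *k v - d *k v.
Proof. by rewrite !scalerBl. Qed.
Lemma kscaleC M (c : k) (h : H) (v : M) : h *: (c *k v) = c *k (h *: v).
Proof. by rewrite !scalerA mulr_algl mulr_algr. Qed.
Lemma kscaleHA M (c : k) (h : H) (v : M) : (c *: h) *: v = c *k (h *: v).
Proof. by rewrite scalerA mulr_algl. Qed.

Lemma kscaleN1 M (v : M) : (-1) *k v = - v.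
Proof. by rewrite scaleN1r scaleNr scale1r. Qed.

Lemma kscaleK M (c : k) (v : M) : c != 0 -> c^-1 *k (c *k v) = v.
Proof. by move=> c0; rewrite kscaleA mulVf // kscale1. Qed.
Lemma kscale_eq0 M (c : k) (v : M) : c != 0 -> c *k v = 0 -> v = 0.
Proof. by move=> c0 cv; rewrite -(kscaleK v c0) cv scaler0. Qed.

Lemma kGx_basisE (h : H) : h = \sum_(u <- msupp h) h@_u *: (hg u.1 * x ^+ u.2).
Proof.
rewrite [LHS]monalgE; apply: eq_bigr => -[g i] _.
by rewrite [in RHS]HgxE [LHS]malgUZ.
Qed.

(** Linearity over the whole algebra reduces to the scalars, the elements of G
    and x, because the products g x^i form a basis. *)
Lemma linear_of_gens M N (F : M -> N) :
  {morph F : u v / u + v} -> (forall (c : k) v, F (c *k v) = c *k F v) ->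
  (forall g v, F (hg g *: v) = hg g *: F v) -> (forall v, F (x *: v) = x *: F v) ->
  linear F.
Proof.
move=> FD Fk Fg Fx h u v; rewrite FD; congr (_ + _).
have F0 : F 0 = 0 by rewrite -(kscale0 (0 : M)) Fk kscale0.
have Fxn i : F (x ^+ i *: u) = x ^+ i *: F u.
  by elim: i => [|i IH]; rewrite ?expr0 ?scale1r // !exprS -!scalerA Fx IH.
rewrite [in LHS](kGx_basisE h) [in RHS](kGx_basisE h) !scaler_suml.
rewrite (big_morph F FD F0); apply: eq_bigr => -[g i] _.
rewrite [in LHS]kscaleHA [in RHS]kscaleHA Fk; congr (_ *: _).
by rewrite -!scalerA Fg Fxn.
Qed.

Section WeightSpaces.
Variable M : lmodType H.
Implicit Types u v w : M.

Lemma weight0 lam : weight_space lam (0 : M).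
Proof. by move=> g; rewrite !scaler0. Qed.
Lemma weightD lam v w :
  weight_space lam v -> weight_space lam w -> weight_space lam (v + w).
Proof. by move=> hv hw g; rewrite !scalerDr hv hw. Qed.
Lemma weightZ lam (c : k) v : weight_space lam v -> weight_space lam (c *k v).
Proof. by move=> hv g; rewrite kscaleC hv !kscaleA mulrC. Qed.
Lemma x_act_g g v : x *: (hg g *: v) = (chi g)^-1 *k (hg g *: (x *: v)).
Proof.
by rewrite [LHS]scalerA Hxg kscaleHA -(scalerA (hg g) x v).
Qed.

Lemma weight_x lam v : weight_space lam v -> weight_space (chi * lam)%g (x *: v).
Proof.
move=> hv g; have cg := char_neq0 chi g.
have := x_act_g g v; rewrite hv kscaleC => /(congr1 (fun w => chi g *k w)).
by rewrite !kscaleA mulfV // kscale1 => <-.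
Qed.
Lemma weight_xn lam v i :
  weight_space lam v -> weight_space (chi ^+ i * lam)%g (x ^+ i *: v).
Proof.
elim: i => [|i IH] hv; first by rewrite !expr0 mul1g scale1r.
by rewrite exprS expgS -mulgA -scalerA; apply: weight_x; apply: IH.
Qed.

Lemma char_neq_ex lam mu : lam <> mu -> exists g, lam g != mu g.
Proof.
move=> ne; apply: contrapT => H; apply: ne; apply: char_ext => g.
by apply/eqP/negP => /negP Hg; apply: H; exists g.
Qed.

(** Applying g - mu(g), with mu the first weight of the list, removes one term
    and scales the others by lam(g) - mu(g), which is nonzero for a suitable g;
    so the sum of weight spaces is direct in every module, and being a weight
    module is a spanning condition only. *)
Lemma weight_indep (s : seq (character k G)) (f : character k G -> M) :
  uniq s -> (forall lam, weight_space lam (f lam)) ->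
  \sum_(lam <- s) f lam = 0 -> forall lam, lam \in s -> f lam = 0.
Proof.
elim: s f => [//|mu s IH] f /= /andP[mus us] hf.
rewrite big_cons => sum0.
have fs0 lam : lam \in s -> f lam = 0.
  move=> ls; have /char_neq_ex[g gne] : lam <> mu by move=> E; rewrite -E ls in mus.
  have d0 : lam g - mu g != 0 by rewrite subr_eq0.
  apply: (kscale_eq0 d0).
  apply: (IH (fun nu => (nu g - mu g) *k f nu)) => // [nu|]; first exact: weightZ.
  have : hg g *: (f mu + \sum_(nu <- s) f nu) - mu g *k (f mu + \sum_(nu <- s) f nu) = 0.
    by rewrite sum0 !scaler0 subr0.
  rewrite !scalerDr hf opprD addrACA subrr add0r !scaler_sumr -sumrB => E.
  rewrite -[RHS]E; apply: eq_bigr => nu _.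
  by rewrite kscaleB hf.
move=> lam; rewrite inE => /predU1P[->|]; last exact: fs0.
by move: sum0; rewrite big_seq big1 ?addr0.
Qed.

(** The family f lists the weight components of v: it is finitely supported and
    is zero off its support, so that it is unique as a function
    ([weight_dec_uniq]). *)
Definition weight_dec v (f : character k G -> M) : Prop :=
  (forall lam, weight_space lam (f lam)) /\
  exists s, [/\ uniq s, forall lam, lam \notin s -> f lam = 0
                 & v = \sum_(lam <- s) f lam].

Lemma sum_supp (s s' : seq (character k G)) (f : character k G -> M) :
  uniq s -> uniq s' -> {subset s <= s'} -> (forall lam, lam \notin s -> f lam = 0) ->
  \sum_(lam <- s) f lam = \sum_(lam <- s') f lam.
Proof.
move=> us us' ss f0; rewrite [RHS](bigID (mem s)) /=.
rewrite [X in _ = _ + X]big1 ?addr0; last by move=> lam; exact: f0.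
rewrite -[RHS]big_filter; apply: perm_big; apply: uniq_perm => //.
  by rewrite filter_uniq.
move=> lam; rewrite mem_filter; case: (boolP (lam \in s)) => //= /ss -> //.
Qed.

Lemma weight_dec_support v w f g : weight_dec v f -> weight_dec w g -> exists s, [/\ uniq s,
  (forall lam, lam \notin s -> f lam = 0 /\ g lam = 0),
  v = \sum_(lam <- s) f lam & w = \sum_(lam <- s) g lam].
Proof.
move=> [_ [s [us s0 ->]]] [_ [s' [us' s0' ->]]].
have uu := undup_uniq (s ++ s').
exists (undup (s ++ s')); split=> // [lam||].
- by rewrite mem_undup mem_cat negb_or => /andP[/s0 -> /s0' ->].
- by apply: sum_supp => // lam; rewrite mem_undup mem_cat => ->.
- by apply: sum_supp => // lam; rewrite mem_undup mem_cat orbC => ->.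
Qed.

Lemma weight_decZD (c : k) v w f g :
  weight_dec v f -> weight_dec w g -> weight_dec (c *k v + w) (fun lam => c *k f lam + g lam).
Proof.
move=> df dg; have [s [us s0 -> ->]] := weight_dec_support df dg.
split=> [lam|]; first by apply: weightD; [apply: weightZ; case: df|case: dg].
exists s; split=> // [lam /s0[-> ->]|]; first by rewrite scaler0 addr0.
by rewrite scaler_sumr big_split.
Qed.

Lemma weight_dec_uniq v f g : weight_dec v f -> weight_dec v g -> f =1 g.
Proof.
move=> df dg; have [s [us s0 vf vg]] := weight_dec_support df dg; move=> lam.
case: (boolP (lam \in s)) => [ls|/s0[-> ->] //].
apply/eqP; rewrite -subr_eq0; apply/eqP.
apply: (@weight_indep s (fun mu => f mu - g mu)) => // [mu|].
  rewrite -[- g mu]kscaleN1 addrC.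
  by apply: weightD; [apply: weightZ; case: dg|case: df].
by rewrite sumrB -vf -vg subrr.
Qed.

Lemma weight_dec_weight lam v :
  weight_space lam v -> weight_dec v (fun mu => if mu == lam then v else 0).
Proof.
move=> hv; split=> [mu|]; first by case: eqP => [->|_] //; exact: weight0.
exists [:: lam]; split=> // [mu|]; last by rewrite big_seq1 eqxx.
by rewrite inE => /negPf ->.
Qed.

Lemma weight_dec0 : weight_dec 0 (fun=> 0).
Proof.
split=> [lam|]; first exact: weight0.
by exists [::]; split=> //; rewrite big_nil.
Qed.

End WeightSpaces.

(** * Weight modules and functionals *)

Lemma weight_module_dec M : weight_module M -> forall v : M, exists f, weight_dec v f.
Proof.
move=> [span _] v; have [s [f [hf ->]]] := span v.
elim: s => [|lam s [g dg]]; first by rewrite big_nil; exists (fun=> 0); exact: weight_dec0.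
rewrite big_cons -[f lam]kscale1.
by eexists; apply: weight_decZD dg; apply: weight_dec_weight.
Qed.

Lemma weight_module_of_dec M :
  (forall v : M, exists f, weight_dec v f) -> weight_module M.
Proof.
move=> dec; split=> [v|]; last exact: weight_indep.
by have [f [hf [s [_ _ ->]]]] := dec v; exists s, f.
Qed.

Lemma weight_module_ind M (K : M -> Prop) : weight_module M ->
  K 0 -> (forall u v, K u -> K v -> K (u + v)) ->
  (forall lam v, weight_space lam v -> K v) -> forall v, K v.
Proof.
move=> [span _] K0 KD Kw v; have [s [f [hf ->]]] := span v.
by apply: (big_ind K) => // lam _; exact: Kw (hf lam).
Qed.

Lemma weight_module_of_sums M :
  (forall v : M, exists m (w : 'I_m -> M), v = \sum_(i < m) w i /\
     forall i, exists lam, weight_space lam (w i)) -> weight_module M.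
Proof.
move=> sums; apply: weight_module_of_dec => v; have [m [w [-> hw]]] := sums v.
apply: (big_ind (fun v => exists f, weight_dec v f)) => [|u u' [f df] [f' df']|i _].
- by exists (fun=> 0); exact: weight_dec0.
- by rewrite -[u]kscale1; exact: ex_intro (weight_decZD 1 df df').
by have [lam /weight_dec_weight dw] := hw i; eexists; exact: dw.
Qed.

Lemma weight_lin M N (f : {linear M -> N}) lam v :
  weight_space lam v -> weight_space lam (f v).
Proof. by move=> hv g; rewrite -!linearZ hv. Qed.

Lemma weight_module_surj M N (f : {linear M -> N}) :
  (forall w, exists v, f v = w) -> weight_module M -> weight_module N.
Proof.
move=> fs [span _]; apply: weight_module_of_dec => w; have [v <-] := fs w.
have [s [h [hh ->]]] := span v; rewrite linear_sum.
apply: (big_ind (fun v => exists f, weight_dec v f)) => [|u u' [g dg] [g' dg']|lam _].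
- by exists (fun=> 0); exact: weight_dec0.
- by rewrite -[u]kscale1; exact: ex_intro (weight_decZD 1 dg dg').
by eexists; apply: weight_dec_weight; apply: weight_lin.
Qed.

Definition kform M (phi : M -> k) := forall (c : k) u v, phi (c *k u + v) = c * phi u + phi v.

Lemma kform0 M (phi : M -> k) : kform phi -> phi 0 = 0.
Proof.
move=> hp; have := hp 1 0 0; rewrite scaler0 addr0 mul1r => E.
by apply: (addrI (phi 0)); rewrite -E addr0.
Qed.
Lemma kformD M (phi : M -> k) u v : kform phi -> phi (u + v) = phi u + phi v.
Proof. by move=> hp; rewrite -[u in LHS]kscale1 hp mul1r. Qed.
Lemma kformZ M (phi : M -> k) c v : kform phi -> phi (c *k v) = c * phi v.
Proof. by move=> hp; rewrite -[_ *k _]addr0 hp kform0 // addr0. Qed.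

Definition projector M mu (p : M -> M) : Prop :=
  [/\ forall (c : k) u v, p (c *k u + v) = c *k p u + p v,
      forall v, weight_space mu (p v),
      forall v, weight_space mu v -> p v = v
    & forall nu v, nu <> mu -> weight_space nu v -> p v = 0].

Lemma projector_exists M mu : weight_module M -> exists p : M -> M, projector mu p.
Proof.
move=> /weight_module_dec dec; have [d dP] := choice dec.
exists (fun v => d v mu); split=> [c u v|v|v hv|nu v ne hv].
- by rewrite (weight_dec_uniq (dP _) (weight_decZD c (dP u) (dP v))).
- by case: (dP v).
- by rewrite (weight_dec_uniq (dP _) (weight_dec_weight hv)) eqxx.
- by rewrite (weight_dec_uniq (dP _) (weight_dec_weight hv)); case: eqP => // E; case: ne.
Qed.

Lemma projectorD M mu (p : M -> M) u v : projector mu p -> p (u + v) = p u + p v.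
Proof. by move=> [pl _ _ _]; rewrite -[u in LHS]kscale1 pl kscale1. Qed.

Lemma projector0 M mu (p : M -> M) : projector mu p -> p 0 = 0.
Proof. by move=> pP; apply: (addrI (p 0)); rewrite -(projectorD _ _ pP) !addr0. Qed.

(** Linear maps commute with the projections onto weight spaces, so any preimage
    may be replaced by its component of the right weight. *)
Lemma weight_lift M N (f : {linear M -> N}) mu v :
  weight_module M -> weight_module N -> weight_space mu (f v) ->
  exists u, weight_space mu u /\ f u = f v.
Proof.
move=> wM wN hv; have [p pP] := projector_exists mu wM.
have [q qP] := projector_exists mu wN.
have pq u : f (p u) = q (f u).
  move: u; apply: (weight_module_ind wM) => [|u u' E E'|nu u hu].
  - by rewrite (projector0 pP) !linear0 (projector0 qP).
  - by rewrite (projectorD _ _ pP) !linearD E E' (projectorD _ _ qP).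
  have [_ _ pid p0] := pP; have [_ _ qid q0] := qP.
  have [E|ne] := pselect (nu = mu).
    by rewrite E in hu; rewrite pid ?qid //; apply: weight_lin.
  by rewrite (p0 nu) // (q0 nu) ?linear0 //; apply: weight_lin.
exists (p v); split; first by case: pP.
by rewrite pq; case: qP => _ _ -> //.
Qed.

(** Some square matrix with rows in U has largest rank; its row space is then
    all of U, and a column of its cokernel matrix separates w from U. *)
Lemma row_functional d (U : 'rV[k]_d -> Prop) (w : 'rV[k]_d) :
  U 0 -> (forall c u v, U u -> U v -> U (c *: u + v)) -> ~ U w ->
  exists col : 'cV[k]_d, (w *m col) 0 0 = 1 /\ forall u, U u -> u *m col = 0.
Proof.
move=> U0 UD Uw.
have Usum (m : nat) (A : 'M[k]_(m, d)) (u : 'rV[k]_d) :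
    (forall i, U (row i A)) -> (u <= A)%MS -> U u.
  move=> UA /submxP[c ->]; rewrite mulmx_sum_row.
  apply: (big_ind U) => // [v v' Uv Uv'|i _]; first by rewrite -[v]scale1r; apply: UD.
  by rewrite -[_ *: _]addr0; apply: UD.
pose rk r := `[< exists A : 'M[k]_d, (forall i, U (row i A)) /\ \rank A = r >].
have ex0 : exists r, rk r.
  exists 0%N; apply/asboolP; exists 0; split; last exact: mxrank0.
  by move=> i; rewrite row0.
have le r : rk r -> (r <= d)%N.
  by move=> /asboolP[A [_ <-]]; exact: rank_leq_row.
case: (ex_maxnP ex0 le) => r /asboolP[A [UA rA]] max.
have UleA u : U u -> (u <= A)%MS.
  move=> Uu; have Urow i : U (row i (A + u)%MS).
    have : (row i (A + u)%MS <= A + u)%MS by exact: row_sub.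
    case/sub_addsmxP => -[y z] /= ->.
    rewrite -[y *m A]scale1r; apply: UD.
      by apply: (Usum _ A) => //; exact: submxMl.
    by apply: (Usum _ u); [move=> j; rewrite row_id|exact: submxMl].
  have rle : (\rank (A + u)%MS <= \rank A)%N.
    by rewrite rA; apply: max; apply/asboolP; exists (A + u)%MS.
  apply: submx_trans (addsmxSr A u) _.
  by have [_ <-] := mxrank_leqif_sup (addsmxSl A u); rewrite eqn_leq rle mxrankS ?addsmxSl.
have : ~~ (w <= A)%MS by apply/negP => /(Usum _ _ _ UA).
rewrite submxE => /eqP wne.
have [j wj] : exists j, (w *m cokermx A) 0 j != 0.
  apply: contrapT => H; apply: wne; apply/rowP => j; rewrite [RHS]mxE.
  by apply/eqP/negP => /negP Hj; apply: H; exists j.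
have colM (u : 'rV[k]_d) (B : 'M[k]_d) : u *m col j B = col j (u *m B).
  by rewrite !colE mulmxA.
exists (((w *m cokermx A) 0 j)^-1 *: col j (cokermx A)); split=> [|u /UleA].
  by rewrite -scalemxAr colM [LHS]mxE [X in _ * X]mxE mulVf.
rewrite submxE => /eqP uA.
by rewrite -scalemxAr colM uA col0 scaler0.
Qed.

(** Pulling U back along a surjection from row vectors, given by a finite
    spanning family, reduces to [row_functional]; the resulting functional does
    not depend on the chosen lifts, as differences of lifts lie in the pullback
    of 0. *)
Lemma fd_functional M (U : M -> Prop) w : fin_dim M ->
  U 0 -> (forall (c : k) u v, U u -> U v -> U (c *k u + v)) -> ~ U w ->
  exists phi : M -> k, [/\ kform phi, phi w = 1 & forall u, U u -> phi u = 0].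
Proof.
move=> [d [b span]] U0 UD Uw.
pose L (r : 'rV[k]_d) : M := \sum_(i < d) r 0 i *k b i.
have LP c r s : L (c *: r + s) = c *k L r + L s.
  rewrite /L scaler_sumr -big_split; apply: eq_bigr => i _.
  by rewrite !mxE kscaleD kscaleA.
have [l lP] : {l : M -> 'rV[k]_d & forall v, L (l v) = v}.
  apply: (@choice _ _ (fun v r => L r = v)) => v; have [c ->] := span v.
  by exists (\row_i c i); apply: eq_bigr => i _; rewrite mxE.
have L0 : L 0 = 0 by rewrite /L big1 // => i _; rewrite mxE kscale0.
have [|c u v Uu Uv||col [cw c0]] := row_functional (U := fun r => U (L r)) (w := l w).
- by rewrite L0.
- by rewrite LP; apply: UD.
- by rewrite lP.
exists (fun v => (l v *m col) 0 0); split=> // [c u v|u Uu]; last first.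
  by rewrite c0 ?lP // mxE.
apply/eqP; rewrite -subr_eq0; apply/eqP.
have -> : (l (c *k u + v) *m col) 0 0 - (c * (l u *m col) 0 0 + (l v *m col) 0 0)
   = ((l (c *k u + v) - (c *: l u + l v)) *m col) 0 0.
  by rewrite mulmxBl mulmxDl -scalemxAl !mxE.
rewrite c0 ?mxE // -scaleN1r addrC LP LP !lP.
by rewrite kscaleN1 addNr.
Qed.

(** The functional is found on the pullback of U under the projection onto the
    weight space, so that it kills the other weight spaces as well. *)
Lemma weight_functional M mu (U : M -> Prop) (w : M) :
  fin_dim M -> weight_module M -> weight_space mu w ->
  U 0 -> (forall (c : k) u v, U u -> U v -> U (c *k u + v)) -> ~ U w ->
  exists phi : M -> k, [/\ kform phi, phi w = 1,
    forall u, weight_space mu u -> U u -> phi u = 0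
  & forall nu u, nu <> mu -> weight_space nu u -> phi u = 0].
Proof.
move=> fdM wM hw U0 UD Uw; have [p pP] := projector_exists mu wM.
have [pl _ pid p0] := pP.
have [||| phi [phil phiw phiU]] := fd_functional (U := fun v => U (p v)) (w := w) fdM.
- by rewrite (projector0 pP).
- by move=> c u v Uu Uv; rewrite pl; apply: UD.
- by rewrite pid.
exists phi; split=> // [u hu Uu|nu u ne hu]; apply: phiU.
  by rewrite pid.
by rewrite (p0 nu).
Qed.

(** * The cyclic modules as universal objects *)

Lemma act_xnS M i (v : M) : x ^+ i.+1 *: v = x *: (x ^+ i *: v).
Proof. by rewrite exprS [RHS]scalerA. Qed.
Lemma act_xnD M i j (v : M) : x ^+ (i + j) *: v = x ^+ i *: (x ^+ j *: v).
Proof. by rewrite exprD [RHS]scalerA. Qed.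
Lemma act_xnSr M i (v : M) : x ^+ i.+1 *: v = x ^+ i *: (x *: v).
Proof. by rewrite exprSr [RHS]scalerA. Qed.

Section Cyclic.
Variables (t : nat) (lam : character k G) (gam : k).
Hypothesis hgam : gam = 0 \/ (chi ^+ t.+1)%g = 1%g.
Local Notation E := (hmod (cyc_rep lam hgam)).
Local Notation m i := (delta_mx 0 i : E).

Lemma cyc_kE (c : k) (v : E) : c *k v = c *: (v : 'rV[k]_t.+1) :> 'rV[k]_t.+1.
Proof. exact: cyc_scaleE. Qed.
Lemma cyc_actgE g (v : E) : hg g *: v = cyc_rho chi lam g (v : 'rV[k]_t.+1).
Proof. by rewrite -[LHS]/(hact _ _ _) hactU. Qed.
Lemma cyc_actxE (v : E) : x *: v = cyc_X gam (v : 'rV[k]_t.+1).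
Proof. by rewrite -[LHS]/(hact _ _ _) hactU /= cyc_rho1. Qed.

Lemma cyc_weight_coef mu (v : E) (j : 'I_t.+1) : weight_space mu v ->
  (v : 'rV[k]_t.+1) 0 j != 0 -> mu = (chi ^+ j * lam)%g.
Proof.
move=> hv vj; apply: char_ext => g.
have := hv g; rewrite cyc_actgE cyc_kE => /(congr1 (fun r : 'rV[k]_t.+1 => r 0 j)).
by rewrite !mxE => /(mulIf vj) <-; rewrite char_mulE char_expE.
Qed.

Lemma cyc_weight_basis (j : 'I_t.+1) : weight_space (chi ^+ j * lam)%g (m j).
Proof. by move=> g; rewrite cyc_gE cyc_kE char_mulE char_expE. Qed.

Lemma cyc_weight0 : weight_space lam (m 0).
Proof. by have := cyc_weight_basis 0; rewrite /= mul1g. Qed.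

Lemma cyc_act_xn (j : 'I_t.+1) : x ^+ j *: m 0 = m j.
Proof.
case: j => j; elim: j => [|j IH] jt /=.
  by rewrite expr0 scale1r; congr delta_mx; apply: val_inj.
rewrite act_xnS (IH (ltnW jt)); exact: cyc_xE.
Qed.

Lemma cyc_act_x_top : x ^+ t.+1 *: m 0 = gam *k m 0.
Proof.
rewrite act_xnS (cyc_act_xn ord_max) cyc_kE; exact: cyc_x_last.
Qed.

Lemma cyc_sum (v : E) : v = \sum_(j < t.+1) (v : 'rV[k]_t.+1) 0 j *k (x ^+ j *: m 0).
Proof.
rewrite [LHS](matrix_sum_delta (v : 'rV[k]_t.+1)) big_ord1.
apply: eq_bigr => j _.
by rewrite cyc_act_xn cyc_kE.
Qed.

Lemma cyc_ext M (f f' : {linear E -> M}) : f (m 0) = f' (m 0) -> f =1 f'.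
Proof.
move=> ff v; rewrite (cyc_sum v) !linear_sum; apply: eq_bigr => j _.
by rewrite !linearZ ff.
Qed.

Lemma cyc_fin_dim : fin_dim E.
Proof.
exists t.+1, (fun j : 'I_t.+1 => x ^+ j *: m 0) => v.
by exists (fun j => (v : 'rV[k]_t.+1) 0 j); exact: cyc_sum.
Qed.

Lemma cyc_weight_module : weight_module E.
Proof.
apply: weight_module_of_sums => v; exists t.+1.
exists (fun j : 'I_t.+1 => (v : 'rV[k]_t.+1) 0 j *k (x ^+ j *: m 0)).
split=> [|j]; first exact: cyc_sum.
by exists (chi ^+ j * lam)%g; apply: weightZ; rewrite cyc_act_xn; exact: cyc_weight_basis.
Qed.

Lemma cyc_m0_neq0 : m 0 <> 0.
Proof.
move=> /(congr1 (fun r : 'rV[k]_t.+1 => r 0 0)); rewrite !mxE !eqxx /=.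
by apply/eqP; exact: oner_neq0.
Qed.

(** The relation on x^(t+1) is exactly what lets the images x^j w of the basis
    vectors wrap around; the module is thus free on a vector of weight lam
    subject to that relation. *)
Lemma cyc_hom M (w : M) : weight_space lam w -> x ^+ t.+1 *: w = gam *k w ->
  exists f : {linear E -> M}, f (m 0) = w.
Proof.
move=> hw xw.
pose F (v : E) : M := \sum_(j < t.+1) (v : 'rV[k]_t.+1) 0 j *k (x ^+ j *: w).
have [f fE] : exists f : {linear E -> M}, forall v, f v = F v.
  apply: linear_of_fun; apply: linear_of_gens => [u v|c v|g v|v].
  - by rewrite /F -big_split; apply: eq_bigr => j _; rewrite mxE kscaleD.
  - rewrite /F scaler_sumr; apply: eq_bigr => j _.
    by rewrite cyc_kE mxE kscaleA.
  - rewrite /F scaler_sumr; apply: eq_bigr => j _.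
    rewrite cyc_actgE mxE kscaleC (weight_xn j hw) kscaleA.
    by rewrite mulrC char_mulE char_expE.
  rewrite /F scaler_sumr big_ord_recl big_ord_recr addrC cyc_actxE.
  congr (_ + _).
    apply: eq_bigr => j _; rewrite mxE /= mul1r kscaleC -act_xnS; congr (_ *k _).
    congr ((v : 'rV[k]_t.+1) 0 _); apply: val_inj.
    by rewrite /= add0n modnDr modn_small // ltnS ltnW.
  rewrite mxE /= kscaleC -act_xnS xw kscaleA expr0 scale1r mulrC; congr (_ *k _).
  congr ((v : 'rV[k]_t.+1) 0 _ * _); apply: val_inj.
  by rewrite /= modn_small.
exists f; rewrite fE /F (bigD1 ord0) //= mxE !eqxx kscale1 expr0 scale1r.
rewrite big1 ?addr0 // => j /negPf j0.
by rewrite mxE j0 andbF kscale0.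
Qed.

(** The coordinates of the image of v are forced by the last one, phi v, as x
    shifts them; hence coordinate j is phi (x^(t - j) v), and the last
    hypothesis expresses compatibility at the wrap-around. *)
Lemma cyc_cohom M (phi : M -> k) : weight_module M -> kform phi ->
  (forall nu v, nu <> (chi ^+ t * lam)%g -> weight_space nu v -> phi v = 0) ->
  (forall v, phi (x ^+ t.+1 *: v) = gam * phi v) ->
  exists f : {linear M -> E}, forall v,
    f v = \row_(j < t.+1) phi (x ^+ (t - j) *: v) :> 'rV[k]_t.+1.
Proof.
move=> wM phil phi0 phix.
pose F (v : M) : E := \row_(j < t.+1) phi (x ^+ (t - j) *: v).
apply: linear_of_fun; apply: (linear_of_gens (F := F)) => [u v|c v|g v|v].
- by apply/rowP => j; rewrite !mxE scalerDr kformD.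
- by apply/rowP => j; rewrite cyc_kE !mxE kscaleC kformZ.
- rewrite cyc_actgE; move: v; apply: (weight_module_ind wM) => [|u v Eu Ev|nu v hv].
  + by apply/rowP => j; rewrite !mxE !scaler0 kform0 // mulr0.
  + have FD u' v' : F (u' + v') = F u' + F v'.
      by apply/rowP => j; rewrite !mxE scalerDr kformD.
    by rewrite scalerDr !FD Eu Ev linearD.
  apply/rowP => j; rewrite !mxE hv kscaleC kformZ //.
  have [Enu|ne] := pselect (chi ^+ (t - j) * nu = chi ^+ t * lam)%g; last first.
    by rewrite (phi0 _ _ ne) ?mulr0 //; exact: weight_xn.
  congr (_ * _); have jt : (j <= t)%N by rewrite -ltnS.
  have := congr1 (fun c : character k G => c g) Enu.
  have -> : (chi ^+ t = chi ^+ (t - j) * chi ^+ j)%g by rewrite -expgnDr subnK.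
  rewrite !char_mulE !char_expE -mulrA.
  by apply: mulfI; rewrite expf_neq0 // char_neq0.
apply/rowP => j; rewrite cyc_actxE !mxE -act_xnSr.
case: eqP => [j0|/eqP].
  by rewrite j0 subn0 phix /= j0 add0n modn_small // subnn expr0 scale1r.
rewrite -lt0n => j0; rewrite mul1r; congr (phi (_ ^+ _ *: _)).
rewrite /= -(prednK j0) addSn /= modnDr modn_small ?subnSK //.
- by rewrite prednK // -ltnS.
- by rewrite (leq_ltn_trans (leq_pred j)).
Qed.

End Cyclic.
End WeightVectors.

(** * Finite dimensional indecomposable projectives *)

Lemma surj_epimorphism (R : nzRingType) (W : lmodType R -> Prop)
    (M N : lmodType R) (f : {linear M -> N}) :
  (forall y, exists m, f m = y) -> epimorphism W f.
Proof. by move=> fs Q u v _ uv y; have [m <-] := fs y. Qed.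

(** The common setting: z is the generator of the ideal, n = t + 1, and gam
    gives the scalar by which x^n acts on each weight space of an object.  The
    module E(lam) is the projective cover of a simple object: of S(lam) when
    gam lam = 0, and of itself otherwise. *)
Section Category.
Variables (k : fieldType) (G : groupType) (chi : character k G).
Local Notation H := (kGx chi).
Local Notation "c *k v" := ((c%:A : H) *: v) (at level 40).
Local Notation x := (Hx chi).
Local Notation hg := (Hg chi).
Implicit Types (M N P : lmodType H) (lam mu nu : character k G).

Variables (t : nat) (z : H) (gam : character k G -> k) (a : G).
Hypothesis z_weight : forall M lam (v : M), weight_space lam v ->
  z *: v = x ^+ t.+1 *: v - gam lam *k v.
Hypothesis gam_cyc : forall lam, gam lam = 0 \/ (chi ^+ t.+1)%g = 1%g.
Hypothesis gam_chi : forall lam, gam (chi * lam)%g = gam lam.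
Hypothesis chi_pow : forall j, (0 < j <= t)%N -> chi a ^+ j != 1.
Local Notation W := (Wprime (ideal_gen z)).
Local Notation E lam := (hmod (cyc_rep lam (gam_cyc lam))).
Local Notation e lam := (delta_mx 0 0 : E lam).
Local Notation S lam := (Vnil chi 1 lam).
Local Notation s lam := (delta_mx 0 0 : S lam).

Lemma gam_chin i lam : gam (chi ^+ i * lam)%g = gam lam.
Proof. by elim: i => [|i IH]; rewrite ?mul1g // expgS -mulgA gam_chi. Qed.

Lemma Wprime_of_z M : weight_module M -> (forall v : M, z *: v = 0) -> W M.
Proof.
move=> wM zM; split=> // h [m [p [q ->]]] v.
rewrite scaler_suml big1 // => i _.
by rewrite -(scalerA (p i * z)) -(scalerA (p i)) zM scaler0.
Qed.

Lemma Wprime_xn M lam (v : M) : W M -> weight_space lam v -> x ^+ t.+1 *: v = gam lam *k v.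
Proof.
move=> [ann _] hv; apply/eqP; rewrite -subr_eq0 -z_weight //; apply/eqP.
apply: ann; exists 1%N, (fun=> 1), (fun=> 1).
by rewrite big_ord1 mul1r mulr1.
Qed.

Lemma Wprime_surj M N (f : {linear M -> N}) :
  (forall y, exists m, f m = y) -> W M -> W N.
Proof.
move=> fs [ann wM]; split; last exact: weight_module_surj wM.
by move=> h Ih v; have [m <-] := fs v; rewrite -linearZ ann // linear0.
Qed.

(** An epimorphism cannot distinguish the projection to its cokernel, an object
    of the category, from zero. *)
Lemma epimorphism_surj M N (f : {linear M -> N}) :
  W N -> epimorphism W f -> forall y, exists m, f m = y.
Proof.
move=> WN epi y; have [pi [pis pi0]] := to_coker_spec f.
have [o oE] : exists o : {linear N -> coker f}, forall v, o v = 0.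
  by apply: linear_of_fun => c u v; rewrite scaler0 addr0.
have : pi y = o y.
  apply: epi; first exact: Wprime_surj pis WN.
  by move=> m; rewrite oE; apply/pi0; exists m.
by rewrite oE => /pi0[m ->]; exists m.
Qed.

Lemma cover_Wprime lam : W (E lam).
Proof.
apply: Wprime_of_z; first exact: cyc_weight_module.
move=> v; rewrite (cyc_sum v) scaler_sumr big1 // => j _.
rewrite kscaleC; have hj := weight_xn j (cyc_weight0 lam (gam_cyc lam)).
rewrite (z_weight hj) -act_xnD addnC act_xnD cyc_act_x_top kscaleC gam_chin.
by rewrite subrr scaler0.
Qed.

Lemma simple_Wprime lam : gam lam = 0 -> W (S lam).
Proof.
move=> g0; apply: Wprime_of_z; first exact: cyc_weight_module.
move=> v; rewrite (cyc_sum v) scaler_sumr big1 // => j _.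
rewrite kscaleC ord1 expr0 scale1r (z_weight (cyc_weight0 _ _)) g0 kscale0 subr0.
by rewrite -(addn1 t) act_xnD (cyc_act_x_top (t := 0)) kscale0 !scaler0.
Qed.

(** The weights chi^j lam with 0 < j <= r differ from lam at a.  The case r = t
    is about E(lam), the case r = 0 about S(lam). *)
Lemma cyc_weight_line r lam c (h : c = 0 \/ (chi ^+ r.+1)%g = 1%g) (v : hmod (cyc_rep lam h)) :
  (r <= t)%N -> weight_space lam v ->
  v = (v : 'rV[k]_r.+1) 0 0 *k (delta_mx 0 0 : hmod (cyc_rep lam h)).
Proof.
move=> rt hv; rewrite cyc_kE; apply/rowP => j; rewrite !mxE /=.
have [->|j0] := eqVneq j 0; first by rewrite mulr1.
rewrite mulr0; apply/eqP; apply: contraT => vj.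
have /(congr1 (fun f : character k G => f a)) := cyc_weight_coef hv vj.
rewrite char_mulE char_expE => /eqP.
rewrite -{1}[lam a]mul1r (inj_eq (mulIf (char_neq0 lam a))) eq_sym.
apply/contraLR => _; apply: chi_pow; rewrite lt0n j0 /=.
by apply: leq_trans rt; rewrite -ltnS.
Qed.

(** The image of m_0 lifts to a weight vector of weight lam, which is the image
    of m_0 under a map from E(lam). *)
Lemma cover_projective lam : projective_object W (E lam).
Proof.
split=> [|M N f g WM WN epi]; first exact: cover_Wprime.
have [m fm] := epimorphism_surj WN epi (g (e lam)).
have hw : weight_space lam (f m) by rewrite fm; apply/weight_lin/cyc_weight0.
have [u [hu fu]] := weight_lift (proj2 WM) (proj2 WN) hw.
have [h hE] := cyc_hom (gam_cyc lam) hu (Wprime_xn WM hu).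
exists h => p; apply: (cyc_ext (f := f \o h) (f' := g)).
by rewrite /= hE fu fm.
Qed.

(** Each component of f is onto and determined by its value on m_0. *)
Lemma cover_component0 lam (A B : lmodType H) (f : {linear E lam -> (A * B)%type}) :
  bijective f -> ((f (e lam)).1 = 0 -> zero_module A) /\
                 ((f (e lam)).2 = 0 -> zero_module B).
Proof.
move=> [g fK gK].
have kill (C : lmodType H) (p : {linear (A * B)%type -> C}) : (forall c, exists q, p q = c) ->
    p (f (e lam)) = 0 -> zero_module C.
  move=> ps pe c; have [q <-] := ps c; rewrite -(gK q).
  have [o oE] : exists o : {linear E lam -> C}, forall v, o v = 0.
    by apply: linear_of_fun => d u v; rewrite scaler0 addr0.
  rewrite -[RHS](oE (g q)); apply: (cyc_ext (f := p \o f) (f' := o)).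
  by rewrite /= pe oE.
split=> [fe0|fe0].
  by apply: (kill A fst) fe0 => c; exists (c, 0).
by apply: (kill B snd) fe0 => c; exists (0, c).
Qed.

(** The projection to the first summand preserves the line of weight lam, so
    being idempotent it is 0 or 1 on it, and one component of the image of m_0
    vanishes. *)
Lemma cover_indecomposable lam : indecomposable W (E lam).
Proof.
split=> [/(_ (e lam))|A B _ _ [f fb]]; first exact: cyc_m0_neq0.
have [A0 B0] := cover_component0 fb; have [g fK gK] := fb.
have he := weight_lin f (cyc_weight0 lam (gam_cyc lam)).
pose v := g ((f (e lam)).1, 0).
have fv : f v = ((f (e lam)).1, 0) by exact: gK.
have hv : weight_space lam v.
  move=> h; apply: (can_inj fK); rewrite !linearZ fv.
  have /(congr1 fst) /= hq := he h.
  apply: injective_projections; first exact: hq.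
  by transitivity (0 : B); [exact: scaler0|exact/esym/scaler0].
have vE := cyc_weight_line (leqnn t) hv; set c := (v : 'rV[k]_t.+1) 0 0 in vE.
have [c0|c0] := eqVneq c 0.
  left; apply: A0; have := fv; rewrite vE c0 kscale0 linear0.
  by move=> /(congr1 fst) /= <-.
right; apply: B0; apply: (kscale_eq0 c0); have := fv; rewrite vE linearZ.
by move=> /(congr1 snd).
Qed.

Lemma cover_fd_indec_proj lam : fd_indec_proj (ideal_gen z) (E lam).
Proof.
split; [exact: cyc_fin_dim|exact: cover_indecomposable|exact: cover_projective].
Qed.

(** A map hitting m_0 has a section g, since m_0 lifts to a vector of weight
    lam; then P is the direct sum of E(lam) and the cokernel of g, which must
    vanish. *)
Lemma iso_cover_of_hit P lam (f : {linear P -> E lam}) (w : P) :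
  indecomposable W P -> W P -> f w = e lam -> iso_mod P (E lam).
Proof.
move=> [_ indec] WP fw.
have hw : weight_space lam (f w) by rewrite fw; exact: cyc_weight0.
have [u [hu fu]] := weight_lift (proj2 WP) (proj2 (cover_Wprime lam)) hw.
have [g gE] := cyc_hom (gam_cyc lam) hu (Wprime_xn WP hu).
have fg v : f (g v) = v.
  by apply: (cyc_ext (f := f \o g) (f' := idfun)); rewrite /= gE fu fw.
have [pi [pis pi0]] := to_coker_spec g.
have [F FE] : exists F : {linear P -> (E lam * coker g)%type}, forall v, F v = (f v, pi v).
  by apply: linear_of_fun => c v v'; rewrite !linearP.
have Finj v : F v = 0 -> v = 0.
  by rewrite FE => -[fv /pi0[m vm]]; move: fv; rewrite vm fg => ->; rewrite linear0.
have : iso_mod P (E lam * coker g)%type.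
  exists F; have [h hE] : {h & forall q, F (h q) = q}.
    apply: (@choice _ _ (fun q v => F v = q)) => -[v q]; have [y <-] := pis q.
    exists (y + g (v - f y)); rewrite FE; congr (_, _).
      by rewrite linearD fg addrCA subrr addr0.
    have -> : pi (y + g (v - f y)) = pi y + pi (g (v - f y)) by exact: linearD.
    have -> : pi (g (v - f y)) = 0 by apply/pi0; exists (v - f y).
    exact: addr0.
  exists h => // v; apply/eqP; rewrite -subr_eq0; apply/eqP; apply: Finj.
  by rewrite linearB hE subrr.
case/indec => [||/(_ (e lam)) /cyc_m0_neq0 //|c0]; first exact: cover_Wprime.
  exact: Wprime_surj pis WP.
exists f, g => [v|v]; last exact: fg.
by have /pi0[m ->] := c0 (pi v); rewrite fg.
Qed.

(** As x (x^t w) = gam lam w, the vector x^t w is nonzero.  A functional with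
    value 1 on it corresponds to a map to E(lam) whose coordinate of index 0 at
    w is 1. *)
Lemma hit_cover_regular P lam (w : P) : fin_dim P -> W P ->
  weight_space lam w -> w <> 0 -> gam lam <> 0 ->
  exists f : {linear P -> E lam}, f w = e lam.
Proof.
move=> fdP WP hw w0 /eqP g0; have wP := proj2 WP.
have ht := weight_xn t hw.
have [|||phi [phil phiw phi0 phin]] := weight_functional (U := fun u => u = 0) fdP wP ht.
- by [].
- by move=> c u v -> ->; rewrite scaler0 addr0.
- move=> xw; apply: w0; apply: (kscale_eq0 g0).
  by rewrite -(Wprime_xn WP hw) act_xnS xw scaler0.
have phix v : phi (x ^+ t.+1 *: v) = gam lam * phi v.
  move: v; apply: (weight_module_ind wP) => [|u v Eu Ev|nu v hv].
  - by rewrite scaler0 kform0 // mulr0.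
  - by rewrite scalerDr !kformD // Eu Ev mulrDr.
  rewrite (Wprime_xn WP hv) kformZ //.
  have [->|ne] := pselect (nu = chi ^+ t * lam)%g; first by rewrite gam_chin.
  by rewrite (phin nu) // !mulr0.
have [f fE] := cyc_cohom (gam_cyc lam) wP phil phin phix.
exists f; rewrite (cyc_weight_line (leqnn t) (weight_lin f hw)) fE mxE subn0 phiw.
exact: kscale1.
Qed.

(** Here x is nilpotent, so some weight vector w lies outside xP; a functional
    killing xP but not w is a map from P to a one-dimensional module S, and it
    lifts along E(lam) -> S because P is projective. *)
Lemma hit_cover_nilpotent P : fin_dim P -> projective_object W P -> ~ zero_module P ->
  (forall lam (w : P), weight_space lam w -> w <> 0 -> gam lam = 0) ->
  exists lam (f : {linear P -> E lam}) (w : P), f w = e lam.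
Proof.
move=> fdP [WP projP] nz g0; have wP := proj2 WP.
have xn0 (v : P) : x ^+ t.+1 *: v = 0.
  move: v; apply: (weight_module_ind wP) => [|u v Eu Ev|nu v hv].
  - by rewrite scaler0.
  - by rewrite scalerDr Eu Ev addr0.
  rewrite (Wprime_xn WP hv); have [->|v0] := pselect (v = 0); first by rewrite scaler0.
  by rewrite (g0 nu v) // kscale0.
have [lam [w [hw wx]]] : exists lam (w : P), weight_space lam w /\ ~ exists u, w = x *: u.
  apply: contrapT => none; apply: nz.
  have xP (v : P) : exists u, v = x *: u.
    move: v; apply: (weight_module_ind wP) => [|_ _ [u ->] [v ->]|nu v hv].
    - by exists 0; rewrite scaler0.
    - by exists (u + v); rewrite scalerDr.
    by apply: contrapT => H; apply: none; exists nu, v.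
  have xnP i (v : P) : exists u, v = x ^+ i *: u.
    elim: i => [|i [u ->]]; first by exists v; rewrite expr0 scale1r.
    by have [u' ->] := xP u; exists u'; rewrite act_xnSr.
  by move=> v; have [u ->] := xnP t.+1 v.
have w0 : w <> 0 by move=> w0; apply: wx; exists 0; rewrite scaler0.
have gl := g0 _ _ hw w0.
have [|||phi [phil phiw phi0 phin]] :=
  weight_functional (U := fun v => exists u, v = x *: u) fdP wP hw.
- by exists 0; rewrite scaler0.
- by move=> c _ _ [u ->] [v ->]; exists (c *k u + v); rewrite scalerDr kscaleC.
- exact: wx.
have phix (v : P) : phi (x ^+ 1 *: v) = 0 * phi v.
  rewrite mul0r expr1; move: v; apply: (weight_module_ind wP) => [|u v Eu Ev|nu v hv].
  - by rewrite scaler0 kform0.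
  - by rewrite scalerDr !kformD // Eu Ev addr0.
  have hx := weight_x hv.
  have [wE|ne] := pselect (chi * nu = lam)%g; last exact: phin ne hx.
  by rewrite wE in hx; apply: phi0 hx _; exists v.
have [|f0 f0E] := @cyc_cohom _ _ chi 0 lam 0 (or_introl erefl) P phi wP phil _ phix.
  by move=> nu v; rewrite mul1g; exact: phin.
have WS := simple_Wprime gl.
have hs : weight_space lam (s lam) by exact: cyc_weight0.
have [p pE] := cyc_hom (gam_cyc lam) hs (Wprime_xn WS hs).
have f0w : f0 w = s lam.
  rewrite (@cyc_weight_line 0 _ _ _ (f0 w) _ (weight_lin f0 hw)) // f0E mxE expr0 scale1r.
  by rewrite phiw kscale1.
have ps y : exists m, p m = y.
  exists ((y : 'rV[k]_1) 0 0 *k e lam); rewrite linearZ pE [RHS]cyc_sum big_ord1.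
  by rewrite expr0 scale1r.
have [f fE] := projP _ _ p f0 (cover_Wprime lam) WS (surj_epimorphism ps).
exists lam, f, w; rewrite (cyc_weight_line (leqnn t) (weight_lin f hw)).
set c := (f w : 'rV[k]_t.+1) 0 0.
have cs : c *k s lam = s lam.
  rewrite -[RHS]f0w -fE.
  rewrite [X in p X](cyc_weight_line (leqnn t) (weight_lin f hw)) -/c.
  by rewrite [RHS]linearZ pE.
have c1 : c = 1.
  by have := congr1 (fun r : 'rV[k]_1 => r 0 0) cs; rewrite cyc_kE !mxE mulr1.
by rewrite c1 kscale1.
Qed.

Lemma fd_indec_proj_iso_cover P :
  fd_indec_proj (ideal_gen z) P -> exists lam, iso_mod P (E lam).
Proof.
move=> [fdP indP projP]; have [WP _] := projP.
suff [lam [f [w fw]]] : exists lam (f : {linear P -> E lam}) (w : P), f w = e lam.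
  by exists lam; exact: iso_cover_of_hit fw.
have [[lam [w [hw w0 g0]]]|none] :=
  pselect (exists lam (w : P), [/\ weight_space lam w, w <> 0 & gam lam <> 0]).
  by have [f fw] := hit_cover_regular fdP WP hw w0 g0; exists lam, f, w.
apply: hit_cover_nilpotent => //; first by case: indP.
by move=> lam w hw w0; apply: contrapT => g0; apply: none; exists lam, w.
Qed.

Lemma cover_iso_weight lam mu : iso_mod (E lam) (E mu) ->
  exists i, lam = (chi ^+ i * mu)%g.
Proof.
move=> [f fb]; have hv := weight_lin f (cyc_weight0 lam (gam_cyc lam)).
have [j vj] : exists j, (f (e lam) : 'rV[k]_t.+1) 0 j != 0.
  apply: contrapT => none; apply: (@cyc_m0_neq0 _ _ _ _ lam _ (gam_cyc lam)).
  apply: (bij_inj fb); rewrite linear0; apply/rowP => j; rewrite [RHS]mxE.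
  by apply/eqP/negP => /negP vj; apply: none; exists j.
by exists j; exact: cyc_weight_coef hv vj.
Qed.

(** When x is nilpotent on E(mu), x^t kills every vector without component
    along m_0, whereas x^t m_0 <> 0 in E(lam). *)
Lemma cover_iso_nilpotent lam mu : gam mu = 0 -> iso_mod (E lam) (E mu) -> lam = mu.
Proof.
move=> g0 [f fb]; have hv := weight_lin f (cyc_weight0 lam (gam_cyc lam)).
have [v0|/(cyc_weight_coef hv)] := eqVneq ((f (e lam) : 'rV[k]_t.+1) 0 0) 0; last first.
  by rewrite mul1g.
have gmu M (v : M) : gam mu *k v = 0 by rewrite g0 kscale0.
have : f (x ^+ t *: e lam) = f 0.
  rewrite linear0 linearZ /= (cyc_sum (f (e lam))) scaler_sumr big1 // => j _.
  have [->|j0] := eqVneq j 0; first by rewrite v0 kscale0 scaler0.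
  have jS : j = j.-1.+1 :> nat by rewrite prednK // lt0n.
  rewrite kscaleC -act_xnD jS addnS -addSn addnC act_xnD cyc_act_x_top.
  by rewrite gmu !scaler0.
move=> /(bij_inj fb); rewrite (cyc_act_xn lam (gam_cyc lam) ord_max).
move=> /(congr1 (fun r : 'rV[k]_t.+1 => r 0 ord_max)).
by rewrite !mxE !eqxx => /eqP; rewrite oner_eq0.
Qed.

(** Mutually inverse maps send m_0 to x m_0 and m_0 to (gam lam)^-1 x^t m_0. *)
Lemma cover_shift lam : gam lam != 0 -> iso_mod (E (chi * lam)%g) (E lam).
Proof.
move=> g0; have chin : (chi ^+ t.+1)%g = 1%g.
  by case: (gam_cyc lam) g0 => // ->; rewrite eqxx.
have hx := weight_x (cyc_weight0 lam (gam_cyc lam)).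
have [f fE] := cyc_hom (gam_cyc (chi * lam)%g) hx (Wprime_xn (cover_Wprime lam) hx).
pose w : E (chi * lam)%g := (gam lam)^-1 *k (x ^+ t *: e (chi * lam)%g).
have hw : weight_space lam w.
  rewrite /w; apply: weightZ.
  have := weight_xn t (cyc_weight0 (chi * lam)%g (gam_cyc (chi * lam)%g)).
  by rewrite mulgA -expgSr chin mul1g.
have [g gE] := cyc_hom (gam_cyc lam) hw (Wprime_xn (cover_Wprime _) hw).
exists f, g => v.
  apply: (cyc_ext (f := g \o f) (f' := idfun)).
  rewrite /= fE linearZ /= gE /w kscaleC -act_xnS cyc_act_x_top.
  have gV : (gam lam)^-1 * gam (chi * lam)%g = 1 by rewrite gam_chi mulVf.
  by rewrite kscaleA gV kscale1.
apply: (cyc_ext (f := f \o g) (f' := idfun)).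
by rewrite /= gE /w !linearZ /= fE -act_xnSr cyc_act_x_top kscaleK.
Qed.

Lemma cover_shiftn lam i : gam lam != 0 -> iso_mod (E (chi ^+ i * lam)%g) (E lam).
Proof.
move=> g0; elim: i => [|i IH]; first by rewrite mul1g; exact: iso_mod_refl.
rewrite expgS -mulgA; apply: iso_mod_trans IH; apply: cover_shift.
by rewrite gam_chin.
Qed.

End Category.

(** * The two families *)

Section Main.
Variables (k : fieldType) (G : groupType) (chi : character k G) (a : G).
Local Notation H := (kGx chi).
Local Notation "c *k v" := ((c%:A : H) *: v) (at level 40).
Local Notation x := (Hx chi).
Local Notation hg := (Hg chi).

(** The two modules differ only in the value of a parameter and in the proof
    attached to it. *)
Lemma Vnil_of_cyc n lam g (h : g = 0 \/ (chi ^+ n)%g = 1%g) :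
  g = 0 -> hmod (cyc_rep lam h) = Vnil chi n lam.
Proof.
by move=> g0; subst g; rewrite (Prop_irrelevance h (or_introl erefl)).
Qed.

Lemma chi_a_pow t : t.+1.-primitive_root ((chi^-1)%g a) ->
  forall j, (0 < j <= t)%N -> chi a ^+ j != 1.
Proof.
move=> prim j /andP[j0 jt]; apply/negP => /eqP aj.
have : ((chi^-1)%g a) ^+ j == 1 by rewrite char_invE exprVn aj invr1.
by rewrite -(prim_order_dvd prim) gtnNdvd.
Qed.

Lemma act_relation_b n (beta : k) (M : lmodType H) (lam : character k G) (v : M) :
  weight_space lam v ->
  (x ^+ n - beta *: (1 - hg a ^+ n)) *: v =
  x ^+ n *: v - (beta * (1 - lam a ^+ n)) *k v.
Proof.
move=> hv; rewrite scalerBl kscaleHA scalerBl scale1r.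
have -> : hg a ^+ n *: v = (lam a ^+ n) *k v.
  elim: n => [|n IH]; first by rewrite !expr0 scale1r kscale1.
  by rewrite !exprS -scalerA IH kscaleC hv kscaleA mulrC.
by rewrite -[X in _ *k (X - _)]kscale1 -kscaleB kscaleA.
Qed.

Lemma Vnil_representative t : t.+1.-primitive_root ((chi^-1)%g a) ->
  representative_family (fd_indec_proj (ideal_gen (x ^+ t.+1)))
    (fun lam : character k G => Vnil chi t.+1 lam).
Proof.
move=> prim; have ca := chi_a_pow prim.
have zw (M : lmodType H) (lam : character k G) (v : M) : weight_space lam v ->
    x ^+ t.+1 *: v = x ^+ t.+1 *: v - 0 *k v.
  by move=> _; rewrite kscale0 subr0.
pose gc (lam : character k G) : 0 = 0 :> k \/ (chi ^+ t.+1)%g = 1%g := or_introl erefl.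
split=> [lam|P PP|lam mu].
- exact: (cover_fd_indec_proj zw gc (fun=> erefl) ca).
- exact: (fd_indec_proj_iso_cover zw gc (fun=> erefl) ca PP).
- exact: (cover_iso_nilpotent (gam_cyc := gc)).
Qed.

Lemma family_b_representative t (beta : k) (hn : has_order chi t.+1)
    (T : pred (character k G)) :
  t.+1.-primitive_root ((chi^-1)%g a) -> beta != 0 -> transversal_of chi a t.+1 T ->
  representative_family
    (fd_indec_proj (ideal_gen (x ^+ t.+1 - beta *: (1 - hg a ^+ t.+1))))
    (@family_b k G chi a t.+1 hn beta T).
Proof.
move=> prim b0 [Tne Tex]; have ca := chi_a_pow prim.
have chin : (chi ^+ t.+1)%g = 1%g by case: hn.
have chian : chi a ^+ t.+1 = 1 by rewrite -char_expE chin.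
pose gam (lam : character k G) := beta * (1 - lam a ^+ t.+1).
pose gc (lam : character k G) : gam lam = 0 \/ (chi ^+ t.+1)%g = 1%g :=
  or_intror (let: And3 _ e _ := hn in e).
have zw (M : lmodType H) (lam : character k G) (v : M) : weight_space lam v ->
    (x ^+ t.+1 - beta *: (1 - hg a ^+ t.+1)) *: v = x ^+ t.+1 *: v - gam lam *k v.
  exact: act_relation_b.
have gchi (lam : character k G) : gam (chi * lam)%g = gam lam.
  by rewrite /gam char_mulE exprMn chian mul1r.
have g0 (lam : character k G) : (gam lam == 0) = (lam a ^+ t.+1 == 1).
  by rewrite mulf_eq0 (negPf b0) /= subr_eq0; exact: eq_sym.
have comm (f h : character k G) : (f * h = h * f)%g.
  by apply: char_ext => g; rewrite !char_mulE mulrC.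
(* For lam(a)^n = 1 the scalar gam lam vanishes, so E(lam) is Vnil. *)
have famE j : exists lam, @family_b k G chi a t.+1 hn beta T j = hmod (cyc_rep lam (gc lam)) /\
    match j with inl l => lam = val l | inr s => lam = val s end.
  case: j => [[l la]|[s Ts]]; last by exists s.
  by exists l; rewrite /= Vnil_of_cyc //; apply/eqP; rewrite g0.
(* The class and the value lam(a)^n are invariants of E(lam). *)
have cls (lam mu : character k G) :
    iso_mod (hmod (cyc_rep lam (gc lam))) (hmod (cyc_rep mu (gc mu))) ->
    lam a ^+ t.+1 = mu a ^+ t.+1 /\ same_class chi lam mu.
  case/cover_iso_weight => i ->; split.
    by rewrite char_mulE char_expE exprMn exprAC chian expr1n mul1r.
  by exists i; right; rewrite invgM comm mulgA mulgV mul1g.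
split=> [j|P PP|i j].
- have [lam [-> _]] := famE j; exact: (cover_fd_indec_proj zw gc gchi ca).
- have [lam Plam] := fd_indec_proj_iso_cover zw gc gchi ca PP.
  have [la|la] := boolP (lam a ^+ t.+1 == 1).
    exists (inl (exist _ lam la)); rewrite /= -(Vnil_of_cyc lam (gc lam)) //.
    by apply/eqP; rewrite g0.
  have [tau [[Ttau [m hm]] _]] := Tex lam la.
  exists (inr (exist _ tau Ttau)).
  change (iso_mod P (hmod (cyc_rep tau (gc tau)))); apply: iso_mod_trans Plam _.
  have gl : gam lam != 0 by rewrite g0.
  have tauE : tau = (lam * (lam^-1 * tau))%g by rewrite mulgA mulgV mul1g.
  case: hm => hm.
    apply: iso_mod_sym; rewrite tauE hm comm.
    exact: (cover_shiftn zw gc gchi).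
  have lamE : lam = (chi ^+ m * tau)%g.
    by rewrite tauE hm mulgA (comm _ lam) -mulgA mulgV mulg1.
  rewrite lamE; apply: (cover_shiftn zw gc gchi).
  by rewrite -(gam_chin gchi m) -lamE.
have [lam [-> il]] := famE i; have [mu [-> jm]] := famE j => lm.
have [am [m hm]] := cls _ _ lm.
case: i il => [[l la]|[s Ts]] /= il; case: j jm => [[l' la']|[s' Ts']] /= jm.
- have : lam = mu.
    apply: (cover_iso_nilpotent _ lm); apply/eqP; rewrite g0 jm; exact: la'.
  by rewrite il jm => ll; congr inl; apply: val_inj.
- by case/negP: (Tne _ Ts'); rewrite -jm -am il.
- by case/negP: (Tne _ Ts); rewrite -il am jm.
have [tau [_ uniq]] := Tex s (Tne _ Ts).
congr inr; apply: val_inj => /=; rewrite -(uniq s); last first.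
  by split=> //; exists 0%N; left; rewrite mulVg.
by apply: uniq; split=> //; exists m; rewrite -il -jm.
Qed.

End Main.

Theorem corollary4p23 (k : fieldType) (G : groupType) (chi : character k G)
    (a : G) (n : nat)
    (a_central : forall g : G, commute a g)
    (chi_a : chi a != 1)
    (n_ge2 : (2 <= n)%N)
    (prim : n.-primitive_root ((chi^-1)%g a)) :
  representative_family
    (fd_indec_proj (ideal_gen (Hx chi ^+ n)))
    (fun lambda : character k G => Vnil chi n lambda)
  /\
  (forall (beta : k) (hn : has_order chi n) (T : pred (character k G)),
     beta != 0 ->
     (a ^+ n)%g <> 1%g ->
     transversal_of chi a n T ->
     representative_family
       (fd_indec_proj (ideal_gen (Hx chi ^+ n - beta *: (1 - Hg chi a ^+ n))))
       (@family_b k G chi a n hn beta T)).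
Proof.
case: n n_ge2 prim => // t _ prim; split=> [|beta hn T b0 _ Ttr].
  exact: Vnil_representative prim.
exact: family_b_representative.
Qed.
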